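(* Let $\sigma_x,\sigma_u>0$ be given, and consider the system with performance output $y(k)=Cx(k)+D\hat u(k)$ and process noise satisfying $\|d(k)\|_2\le\epsilon_d$ for all $k\ge0$. Suppose there exist matrices $\bar P\in\mathbb{R}^{n_x\times n_x}$, $L\in\mathbb{R}^{n_u\times n_x}$, $G\in\mathbb{R}^{n_u\times n_u}$ and scalars $\gamma>0$, $\bar\alpha_1,\bar\alpha_2,\theta_0,\dots,\theta_{T-1}$ such that $\bar P$ is symmetric positive definite, $\bar\alpha_1\ge0$, $\bar\alpha_2\ge0$, $\theta_0\ge0,\dots,\theta_{T-1}\ge0$, and $$\begin{bmatrix}\mathcal{T}(\bar P)&\mathcal{B}_1(\bar P,L,-G)&0&0&\Xi_1\\ *&\Delta_1&\Xi_2&\mathcal{B}_2(L^\top,\bar P)&0\\ *&*&I&0&0\\ *&*&*&\Delta_2&0\\ *&*&*&*&\gamma^2I\end{bmatrix}\succeq0,$$ where $\Delta_1=\mathrm{blkdiag}(\bar P,\ 2\bar P-\bar\alpha_1I,\ G^\top+G-\bar\alpha_2I)$, $\Delta_2=\mathrm{blkdiag}\left(\frac{\bar\alpha_2}{\sigma_u^2}I_{n_u},\frac{\bar\alpha_1}{\sigma_x^2}I_{n_x}\right)$, $\Xi_1=\begin{bmatrix}E^\top&0&0\end{bmatrix}^\top$ and $\Xi_2=\begin{bmatrix}C\bar P+DL&-DL&-DG\end{bmatrix}^\top$. Then, with the controller gain $K=L\bar P^{-1}$ and Lyapunov matrix $P=\bar P^{-1}$, for every $(A,B)\in\Sigma$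 the $H_\infty$ norm of the event-triggered closed-loop system $$x(k+1)=(A+BK)x(k)-BKe_x(k)-Be_u(k)+Ed(k),\qquad y(k)=Cx(k)+DKx(k)-DKe_x(k)-De_u(k),$$ $$\|e_x(k)\|_2\le\sigma_x\|x(k)\|_2,\quad \|e_u(k)\|_2\le\sigma_u\|u(k)\|_2,\quad u(k)=K(x(k)-e_x(k)),$$ is less than or equal to $\gamma$.
   Context: Dimensions and data. $n_x,n_u,n_d,n_y,T$ are positive integers; $E\in\mathbb{R}^{n_x\times n_d}$, $C\in\mathbb{R}^{n_y\times n_x}$, $D\in\mathbb{R}^{n_y\times n_u}$ are known. The plant is $x(k+1)=A_*x(k)+B_*\hat u(k)+Ed(k)$ with unknown stabilizable $(A_*,B_* )$, $A_*\in\mathbb{R}^{n_x\times n_x}$, $B_*\in\mathbb{R}^{n_x\times n_u}$. In a data collection experiment, with $x(k+1)=A_*x(k)+B_*u(k)+Ed(k)$, one records $x_m(k)=x(k)+\delta_x(k)$ ($k=0,\dots,T$) and $u_m(k)=u(k)+\delta_u(k)$ ($k=0,\dots,T-1$), where $\|d(k)\|_2\le\epsilon_d$ and $\|\delta_u(k)\|_2\le\epsilon_u$ for $k=0,\dots,T-1$ and $\|\delta_x(k)\|_2\le\epsilon_x$ for $k=0,\dots,T$, with known constants $\epsilon_d,\epsilon_x,\epsilon_u>0$. Define for $k=0,\dots,T-1$ $$\Psi_k=F\,\Pi\,F^\top-v_kv_k^\top,\quad F=\begin{bmatrix}E&0&I&0\\0&-I&0&0\\0&0&0&-I\end{bmatrix},\quad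 \Pi=\mathrm{blkdiag}(4\epsilon_d^2I,4\epsilon_x^2I,4\epsilon_x^2I,4\epsilon_u^2I),\quad v_k=\begin{bmatrix}x_m(k+1)\\-x_m(k)\\-u_m(k)\end{bmatrix},$$ where the block sizes in $\Pi$ are $n_d,n_x,n_x,n_u$ and the block rows of $F$ have sizes $n_x,n_x,n_u$. The uncertainty set is $$\Sigma=\bigcap_{k=0}^{T-1}\left\{(A,B)\in\mathbb{R}^{n_x\times n_x}\times\mathbb{R}^{n_x\times n_u}:\ \begin{bmatrix}I\\ A^\top\\ B^\top\end{bmatrix}^\top\Psi_k\begin{bmatrix}I\\ A^\top\\ B^\top\end{bmatrix}\succeq0\right\}.$$ Block notation (block rows of sizes $n_x,n_x,n_u$): $\mathcal{B}_1(X_1,X_2,X_3)=\begin{bmatrix}0&0&0\\ X_1&0&0\\ X_2&-X_2&X_3\end{bmatrix}$ (block columns $n_x,n_x,n_u$), $\mathcal{B}_2(X_1,X_2)=\begin{bmatrix}X_1&X_2\\-X_1&0\\0&0\end{bmatrix}$ (block columns $n_u,n_x$), $\mathcal{T}(X)=\mathrm{blkdiag}(X,0,0)-\sum_{i=0}^{T-1}\theta_i\Psi_i$ (with $X\in\mathbb{R}^{n_x\times n_x}$). The block rows of $\Xi_1,\Xi_2$ have sizes $n_x,n_x,n_u$; the diagonal blocks $I$ and $\gamma^2I$ have sizes $n_y$ and $n_d$. The symbol $*$ denotes blocks determined by symmetry; $\succeq0$ means symmetric positive semidefinite. Event-triggered closed loop. The controller is $u(k)=K\hat x(k)$, where $\hat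 x(k)$ is the most recently transmitted state and $\hat u(k)$ the most recently transmitted input; $e_x(k)=x(k)-\hat x(k)$, $e_u(k)=u(k)-\hat u(k)$. The triggering rules (transmit $x(k)$ when $\|x(k)-\hat x(k)\|_2>\sigma_x\|x(k)\|_2$; transmit $u(k)$ when $\|u(k)-\hat u(k)\|_2>\sigma_u\|u(k)\|_2$; first transmissions at $k=0$) guarantee the two stated error inequalities for all $k\in\mathbb{N}$, and these inequalities are the event-triggered condition. $H_\infty$ norm bound. The closed-loop system has $H_\infty$ norm at most $\gamma>0$ if, for zero initial state $x(0)=0$ and any nonzero square-summable input $d\in l_2[0,+\infty)$ (here with $\|d(k)\|_2\le\epsilon_d$ for all $k$), the output satisfies $\sum_{k=0}^\infty\|y(k)\|_2^2\le\gamma^2\sum_{k=0}^\infty\|d(k)\|_2^2$. The Lyapunov function associated with $P$ is $V(k)=x(k)^\top Px(k)$; it serves as a Lyapunov matrix in the sense that $V(k+1)-V(k)\le\gamma^2d(k)^\top d(k)-y(k)^\top y(k)$ for all $k$. *)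

(* Defs.v *)
From mathcomp Require Import all_boot all_order all_algebra.
From mathcomp Require Import all_classical all_reals all_analysis.
From mathcomp.real_closed Require Import complex.

Set Implicit Arguments.
Unset Strict Implicit.
Unset Printing Implicit Defensive.

Import Order.TTheory GRing.Theory Num.Theory.
Local Open Scope classical_set_scope.
Local Open Scope ring_scope.

(* The Euclidean norm: the canonical norm of a matrix type is the max norm. *)
Definition norm2 (R : realType) n (v : 'cV[R]_n) : R :=
  Num.sqrt (\sum_(i < n) v i 0 ^+ 2).

(* Squared l2 norm of a signal; it equals +oo iff v is not square-summable. *)
Definition energy (R : realType) n (v : nat -> 'cV[R]_n) : \bar R :=
  (\sum_(0 <= k <oo) (norm2 (v k) ^+ 2)%:E)%E.

Definition psdmx (R : realType) n (M : 'M[R]_n) : Prop :=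
  M^T = M /\ forall v : 'cV[R]_n, 0 <= (v^T *m M *m v) 0 0.

Definition posdefmx (R : realType) n (M : 'M[R]_n) : Prop :=
  M^T = M /\ forall v : 'cV[R]_n, v != 0 -> 0 < (v^T *m M *m v) 0 0.

Definition blkdiag (R : realType) m n (A : 'M[R]_m) (B : 'M[R]_n) :
  'M[R]_(m + n) := block_mx A 0 0 B.

(* [A B; * D], the starred block being determined by symmetry *)
Definition symblock (R : realType) m n
    (A : 'M[R]_m) (B : 'M[R]_(m, n)) (D : 'M[R]_n) : 'M[R]_(m + n) :=
  block_mx A B B^T D.

(* Discrete-time stability: the complex spectrum is in the open unit disk. *)
Definition schur_stable (R : realType) n (M : 'M[R]_n) : Prop :=
  forall z : complex R,
    eigenvalue (map_mx (real_complex R) M) z -> `|z| < 1.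

Definition stabilizable (R : realType) nx nu
    (A : 'M[R]_nx) (B : 'M[R]_(nx, nu)) : Prop :=
  exists K : 'M[R]_(nu, nx), schur_stable (A + B *m K).

(* xm and um are the noisy measurements recorded on some run of length T of
   x(k+1) = A x(k) + B u(k) + E d(k); only xm 0, ..., xm T and
   um 0, ..., um (T-1) are meaningful. *)
Definition recorded_data (R : realType) nx nu nd
    (A : 'M[R]_nx) (B : 'M[R]_(nx, nu)) (E : 'M[R]_(nx, nd)) (T : nat)
    (epsd epsx epsu : R)
    (xm : nat -> 'cV[R]_nx) (um : nat -> 'cV[R]_nu) : Prop :=
  exists (x dx : nat -> 'cV[R]_nx) (u du : nat -> 'cV[R]_nu)
         (d : nat -> 'cV[R]_nd),
    (forall k, (k < T)%N ->
       [/\ x k.+1 = A *m x k + B *m u k + E *m d k,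
           um k = u k + du k,
           norm2 (d k) <= epsd
         & norm2 (du k) <= epsu]) /\
    (forall k, (k <= T)%N ->
       xm k = x k + dx k /\ norm2 (dx k) <= epsx).

Definition data_F (R : realType) nx nu nd (E : 'M[R]_(nx, nd)) :
    'M[R]_(nx + (nx + nu), nd + (nx + (nx + nu))) :=
  col_mx (row_mx E (row_mx 0 (row_mx 1%:M 0)))
    (col_mx (row_mx 0 (row_mx (- 1%:M) (row_mx 0 0)))
            (row_mx 0 (row_mx 0 (row_mx 0 (- 1%:M))))).

Definition data_Pi (R : realType) nx nu nd (epsd epsx epsu : R) :
    'M[R]_(nd + (nx + (nx + nu))) :=
  blkdiag (4 * epsd ^+ 2)%:M
    (blkdiag (4 * epsx ^+ 2)%:M
      (blkdiag (4 * epsx ^+ 2)%:M (4 * epsu ^+ 2)%:M)).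

Definition data_v (R : realType) nx nu
    (xm : nat -> 'cV[R]_nx) (um : nat -> 'cV[R]_nu) (k : nat) :
    'cV[R]_(nx + (nx + nu)) :=
  col_mx (xm k.+1) (col_mx (- xm k) (- um k)).

Definition data_Psi (R : realType) nx nu nd (E : 'M[R]_(nx, nd))
    (epsd epsx epsu : R)
    (xm : nat -> 'cV[R]_nx) (um : nat -> 'cV[R]_nu) (k : nat) :
    'M[R]_(nx + (nx + nu)) :=
  data_F nu E *m data_Pi nx nu nd epsd epsx epsu *m (data_F nu E)^T
  - data_v xm um k *m (data_v xm um k)^T.

Definition data_Sigma (R : realType) nx nu nd (E : 'M[R]_(nx, nd)) (T : nat)
    (epsd epsx epsu : R)
    (xm : nat -> 'cV[R]_nx) (um : nat -> 'cV[R]_nu) :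
    set ('M[R]_nx * 'M[R]_(nx, nu)) :=
  \bigcap_(k in [set k : nat | (k < T)%N])
    [set AB | let W := col_mx 1%:M (col_mx AB.1^T AB.2^T) in
              psdmx (W^T *m data_Psi E epsd epsx epsu xm um k *m W)].

Definition blkB1 (R : realType) nx nu
    (X1 : 'M[R]_nx) (X2 : 'M[R]_(nu, nx)) (X3 : 'M[R]_nu) :
    'M[R]_(nx + (nx + nu)) :=
  col_mx (row_mx 0 (row_mx 0 0))
    (col_mx (row_mx X1 (row_mx 0 0))
            (row_mx X2 (row_mx (- X2) X3))).

Definition blkB2 (R : realType) nx nu
    (X1 : 'M[R]_(nx, nu)) (X2 : 'M[R]_nx) :
    'M[R]_(nx + (nx + nu), nu + nx) :=
  col_mx (row_mx X1 X2) (col_mx (row_mx (- X1) 0) (row_mx 0 0)).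

Definition blkT (R : realType) nx nu T (X : 'M[R]_nx)
    (theta : 'I_T -> R) (Psi : nat -> 'M[R]_(nx + (nx + nu))) :
    'M[R]_(nx + (nx + nu)) :=
  blkdiag X (blkdiag 0 0) - \sum_(i < T) theta i *: Psi i.

Definition Delta1 (R : realType) nx nu
    (Pbar : 'M[R]_nx) (G : 'M[R]_nu) (alpha1 alpha2 : R) :
    'M[R]_(nx + (nx + nu)) :=
  blkdiag Pbar (blkdiag (2 *: Pbar - alpha1%:M) (G^T + G - alpha2%:M)).

Definition Delta2 (R : realType) nx nu
    (alpha1 alpha2 sigmax sigmau : R) : 'M[R]_(nu + nx) :=
  blkdiag (alpha2 / sigmau ^+ 2)%:M (alpha1 / sigmax ^+ 2)%:M.

Definition Xi1 (R : realType) nx nu nd (E : 'M[R]_(nx, nd)) :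
    'M[R]_(nx + (nx + nu), nd) :=
  (row_mx E^T (row_mx 0 0))^T.

Definition Xi2 (R : realType) nx nu ny
    (C : 'M[R]_(ny, nx)) (D : 'M[R]_(ny, nu))
    (Pbar : 'M[R]_nx) (L : 'M[R]_(nu, nx)) (G : 'M[R]_nu) :
    'M[R]_(nx + (nx + nu), ny) :=
  (row_mx (C *m Pbar + D *m L) (row_mx (- (D *m L)) (- (D *m G))))^T.

Definition lmi (R : realType) nx nu nd ny T
    (E : 'M[R]_(nx, nd)) (C : 'M[R]_(ny, nx)) (D : 'M[R]_(ny, nu))
    (Psi : nat -> 'M[R]_(nx + (nx + nu)))
    (sigmax sigmau : R)
    (Pbar : 'M[R]_nx) (L : 'M[R]_(nu, nx)) (G : 'M[R]_nu)
    (gamma alpha1 alpha2 : R) (theta : 'I_T -> R) :=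
  symblock (blkT Pbar theta Psi)
    (row_mx (blkB1 Pbar L (- G)) (row_mx 0 (row_mx 0 (Xi1 nu E))))
    (symblock (Delta1 Pbar G alpha1 alpha2)
      (row_mx (Xi2 C D Pbar L G) (row_mx (blkB2 L^T Pbar) 0))
      (symblock (1%:M : 'M[R]_ny)
        (row_mx 0 0)
        (symblock (Delta2 nx nu alpha1 alpha2 sigmax sigmau)
          0
          ((gamma ^+ 2)%:M : 'M[R]_nd)))).

(* The set of trajectories (state x, noise d, output y) of the event-triggered
   closed loop.  The errors ex, eu range over all signals obeying the
   event-triggered condition, and x 0 is left free. *)
Definition closed_loop (R : realType) nx nu nd ny
    (A : 'M[R]_nx) (B : 'M[R]_(nx, nu)) (E : 'M[R]_(nx, nd))
    (C : 'M[R]_(ny, nx)) (D : 'M[R]_(ny, nu)) (K : 'M[R]_(nu, nx))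
    (sigmax sigmau : R)
    (x : nat -> 'cV[R]_nx) (d : nat -> 'cV[R]_nd) (y : nat -> 'cV[R]_ny) :
    Prop :=
  exists (ex : nat -> 'cV[R]_nx) (u eu : nat -> 'cV[R]_nu), forall k,
    [/\ x k.+1 = (A + B *m K) *m x k - B *m K *m ex k - B *m eu k + E *m d k,
        y k = C *m x k + D *m K *m x k - D *m K *m ex k - D *m eu k,
        u k = K *m (x k - ex k),
        norm2 (ex k) <= sigmax * norm2 (x k)
      & norm2 (eu k) <= sigmau * norm2 (u k)].

(* The H_infinity norm is at most gamma, for inputs of pointwise norm at most
   epsd. *)
Definition hinf_norm_le (R : realType) nx nd ny (epsd : R)
    (sys : (nat -> 'cV[R]_nx) -> (nat -> 'cV[R]_nd) -> (nat -> 'cV[R]_ny) ->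
           Prop)
    (gamma : R) : Prop :=
  forall x d y, sys x d y ->
    x 0%N = 0 ->
    (forall k, norm2 (d k) <= epsd) ->
    (exists k, d k != 0) ->
    (energy d < +oo)%E ->
    (energy y <= (gamma ^+ 2)%:E * energy d)%E.

Definition lyapunov_matrix (R : realType) nx nd ny (epsd : R)
    (sys : (nat -> 'cV[R]_nx) -> (nat -> 'cV[R]_nd) -> (nat -> 'cV[R]_ny) ->
           Prop)
    (gamma : R) (P : 'M[R]_nx) : Prop :=
  forall x d y, sys x d y ->
    (forall k, norm2 (d k) <= epsd) ->
    let V k := ((x k)^T *m P *m x k) 0 0 in
    forall k, V k.+1 - V k <=
      gamma ^+ 2 * ((d k)^T *m d k) 0 0 - ((y k)^T *m y k) 0 0.

(* Main.v *)
Require Import Defs.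
From mathcomp Require Import all_boot all_order all_algebra.
From mathcomp Require Import all_classical all_reals all_analysis.
From mathcomp Require Import ring lra.

Set Implicit Arguments.
Unset Strict Implicit.

Import Order.TTheory GRing.Theory Num.Theory.
Local Open Scope classical_set_scope.
Local Open Scope ring_scope.

(** The matrix inequality says that a quadratic form in five block vectors is
    nonnegative.  For a fixed (A, B) in the uncertainty set and one step of the
    closed loop, one evaluates this form at a single vector and reads off the
    dissipation inequality
      V(k+1) - V(k) <= gamma^2 |d|^2 - |y|^2,   V(x) = x^T P x, P = Pbar^-1.

    The vector is chosen as follows.
    - The first block is (p, A^T p, B^T p) with p = - P x(k+1).  On vectors of
      this shape the forms Psi_i are nonnegative, because (A, B) lies in the
      uncertainty set; since theta_i >= 0, these terms only help (this is the
      S-procedure), and only p^T Pbar p = V(k+1) remains of the diagonal block.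
    - The second block is (P x, P e_x, c) with G c = e_u.  Then Pbar P x = x and
      L P = K, so the off-diagonal terms reassemble into 2 p^T x(k+1) =
      - 2 V(k+1), and the coupling with the third block into 2 y^T w.
    - The third block is w = - y, producing - |y|^2, and the last one is d.
    - The fourth block consists of negative multiples of u and x, chosen so that
      the terms in (e_u, u) and in (e_x, x) are each bounded above by
      (|e|^2 - sigma^2 |v|^2) / alpha, which is at most 0 by the event-triggered
      condition ([trigger_multiplier]).

    The multipliers alpha_1, alpha_2 may vanish, and then neither the division
    by alpha nor the invertibility of G is available.  In that case the
    corresponding diagonal entry of the form is zero, so positivity kills the
    off-diagonal entries next to it, which forces x = 0, respectively u = 0; the
    event-triggered condition then gives e_x = 0, respectively e_u = 0, and the
    channel contributes nothing ([lmi_dissipation]).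

    Telescoping the dissipation inequality from x(0) = 0, with V >= 0, bounds
    every partial sum of the output energy, hence the energy itself
    ([energy_le_of_dissipation]). *)

(** * The Euclidean inner product *)

Definition dot (R : realType) n (u v : 'cV[R]_n) : R := (u^T *m v) 0 0.

Lemma dotE (R : realType) n (u v : 'cV[R]_n) :
  dot u v = \sum_(i < n) u i 0 * v i 0.
Proof. by rewrite /dot mxE; apply: eq_bigr => i _; rewrite mxE. Qed.

Lemma dotC (R : realType) n (u v : 'cV[R]_n) : dot u v = dot v u.
Proof. by rewrite !dotE; apply: eq_bigr => i _; rewrite mulrC. Qed.

Lemma dotDr (R : realType) n (u v w : 'cV[R]_n) :
  dot u (v + w) = dot u v + dot u w.
Proof. by rewrite /dot mulmxDr mxE. Qed.

Lemma dotNr (R : realType) n (u v : 'cV[R]_n) : dot u (- v) = - dot u v.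
Proof. by rewrite /dot mulmxN mxE. Qed.

Lemma dotZr (R : realType) n t (u v : 'cV[R]_n) : dot u (t *: v) = t * dot u v.
Proof. by rewrite /dot -scalemxAr mxE. Qed.

Lemma dot0r (R : realType) n (u : 'cV[R]_n) : dot u 0 = 0.
Proof. by rewrite /dot mulmx0 mxE. Qed.

Lemma dotDl (R : realType) n (u v w : 'cV[R]_n) :
  dot (u + v) w = dot u w + dot v w.
Proof. by rewrite dotC dotDr !(dotC w). Qed.

Lemma dotNl (R : realType) n (u v : 'cV[R]_n) : dot (- u) v = - dot u v.
Proof. by rewrite dotC dotNr dotC. Qed.

Lemma dotZl (R : realType) n t (u v : 'cV[R]_n) : dot (t *: u) v = t * dot u v.
Proof. by rewrite dotC dotZr dotC. Qed.

Lemma dot0l (R : realType) n (u : 'cV[R]_n) : dot 0 u = 0.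
Proof. by rewrite dotC dot0r. Qed.

Lemma dot_mulmxl (R : realType) m n (M : 'M[R]_(m, n)) (u : 'cV[R]_n) v :
  dot (M *m u) v = dot u (M^T *m v).
Proof. by rewrite /dot trmx_mul mulmxA. Qed.

Lemma dot_mulmxr (R : realType) m n (M : 'M[R]_(m, n)) (u : 'cV[R]_m) v :
  dot u (M *m v) = dot (M^T *m u) v.
Proof. by rewrite dot_mulmxl trmxK. Qed.

Lemma dot_col (R : realType) m n (a c : 'cV[R]_m) (b d : 'cV[R]_n) :
  dot (col_mx a b) (col_mx c d) = dot a c + dot b d.
Proof. by rewrite /dot tr_col_mx mul_row_col mxE. Qed.

Lemma dotvv_ge0 (R : realType) n (u : 'cV[R]_n) : 0 <= dot u u.
Proof. by rewrite dotE; apply: sumr_ge0 => i _; rewrite -expr2 sqr_ge0. Qed.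

Lemma dotvv_eq0 (R : realType) n (u : 'cV[R]_n) : dot u u = 0 -> u = 0.
Proof.
move=> /eqP; rewrite dotE psumr_eq0 => [|i _]; last by rewrite -expr2 sqr_ge0.
move=> /allP u0; apply/colP => i; rewrite mxE.
by have := u0 i (mem_index_enum i); rewrite /= mulf_eq0 orbb => /eqP.
Qed.

Lemma norm2_sqr (R : realType) n (u : 'cV[R]_n) : norm2 u ^+ 2 = dot u u.
Proof.
rewrite /norm2 sqr_sqrtr; last by apply: sumr_ge0 => i _; rewrite sqr_ge0.
by rewrite dotE; apply: eq_bigr => i _; rewrite expr2.
Qed.

Lemma norm2_le_dot (R : realType) m n (s : R) (u : 'cV[R]_m) (v : 'cV[R]_n) :
  0 < s -> norm2 u <= s * norm2 v -> dot u u <= s ^+ 2 * dot v v.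
Proof.
move=> s0 uv; rewrite -!norm2_sqr -exprMn ler_sqr // nnegrE ?sqrtr_ge0 //.
by rewrite mulr_ge0 ?sqrtr_ge0 // ltW.
Qed.

Lemma psdmx_dot (R : realType) n (M : 'M[R]_n) v :
  psdmx M -> 0 <= dot v (M *m v).
Proof. by case=> _ /(_ v); rewrite /dot mulmxA. Qed.

Lemma posdefmx_dot (R : realType) n (M : 'M[R]_n) v :
  posdefmx M -> v != 0 -> 0 < dot v (M *m v).
Proof. by case=> _ H /H; rewrite /dot mulmxA. Qed.

Lemma unitmx_dot (R : realType) n (M : 'M[R]_n) :
  (forall v, v != 0 -> 0 < dot v (M *m v)) -> M \in unitmx.
Proof.
move=> Mpos; rewrite unitmxE unitfE -det_tr; apply/det0P => -[v v0 vM].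
have := Mpos v^T; rewrite trmx_eq0 => /(_ v0).
by rewrite -[M]trmxK -trmx_mul vM trmx0 dot0r ltxx.
Qed.

Lemma psdmx_invmx (R : realType) n (M : 'M[R]_n) :
  posdefmx M -> psdmx (invmx M).
Proof.
move=> Mpos; have [Msym _] := Mpos.
have Mu : M \in unitmx by apply: unitmx_dot => v; exact: posdefmx_dot.
split=> [|v]; first by rewrite trmx_inv Msym.
have -> : (v^T *m invmx M *m v) 0 0 = dot (invmx M *m v) (M *m (invmx M *m v)).
  by rewrite mulKVmx // dotC /dot mulmxA.
have [->|Mv0] := eqVneq (invmx M *m v) 0; first by rewrite dot0l.
exact/ltW/posdefmx_dot.
Qed.

(** The form in which positivity forces the entries beside a zero diagonal
    entry to vanish. *)
Lemma affine_ge0_slope0 (R : realType) (s r : R) :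
  (forall t, 0 <= s + t * r) -> r = 0.
Proof.
move=> H; apply: contrapT => /eqP r0.
by have := H (- (s + 1) / r); rewrite mulfVK //; lra.
Qed.

(** * The matrix inequality as a quadratic form *)

Lemma dot_symblock (R : realType) m n (A : 'M[R]_m) B (D : 'M[R]_n) u v :
  dot (col_mx u v) (symblock A B D *m col_mx u v) =
  dot u (A *m u) + 2 * dot u (B *m v) + dot v (D *m v).
Proof.
rewrite mul_block_col dot_col !dotDr.
by rewrite -(dot_mulmxl B) (dotC (B *m v)); lra.
Qed.

(** Each coefficient matrix appears in the direction in which it acts on the
    closed-loop signals, so that the terms can be matched with the dynamics
    after substitution of the test vector. *)
Lemma lmi_form (R : realType) (nx nu nd ny T : nat)
    (E : 'M[R]_(nx, nd)) (C : 'M[R]_(ny, nx)) (D : 'M[R]_(ny, nu))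
    (Psi : nat -> 'M[R]_(nx + (nx + nu))) (sigmax sigmau : R)
    (Pbar : 'M[R]_nx) (L : 'M[R]_(nu, nx)) (G : 'M[R]_nu)
    (gamma alpha1 alpha2 : R) (theta : 'I_T -> R)
    (p1 p2 : 'cV[R]_nx) (p3 : 'cV[R]_nu)
    (a b : 'cV[R]_nx) (c : 'cV[R]_nu) (w : 'cV[R]_ny)
    (r : 'cV[R]_nu) (s : 'cV[R]_nx) (d : 'cV[R]_nd) :
  let M := lmi E C D Psi sigmax sigmau Pbar L G gamma alpha1 alpha2 theta in
  let p := col_mx p1 (col_mx p2 p3) in
  let z := col_mx p (col_mx (col_mx a (col_mx b c))
             (col_mx w (col_mx (col_mx r s) d))) in
  dot z (M *m z) =
    dot p1 (Pbar *m p1) - \sum_(i < T) theta i * dot p (Psi i *m p)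
    + 2 * (dot p1 (E *m d) + dot p2 (Pbar *m a)
           + dot p3 (L *m a - L *m b - G *m c))
    + dot a (Pbar *m a)
    + (2 * dot b (Pbar *m b) - alpha1 * dot b b)
    + (2 * dot c (G *m c) - alpha2 * dot c c)
    + 2 * dot ((C *m Pbar + D *m L) *m a - D *m L *m b - D *m G *m c) w
    + dot w w
    + 2 * (dot (L *m a - L *m b) r + dot a (Pbar *m s))
    + alpha2 / sigmau ^+ 2 * dot r r + alpha1 / sigmax ^+ 2 * dot s s
    + gamma ^+ 2 * dot d d.
Proof.
move=> M p z; rewrite /z /M /lmi !dot_symblock.
have blkTE : dot p (blkT Pbar theta Psi *m p) =
    dot p1 (Pbar *m p1) - \sum_(i < T) theta i * dot p (Psi i *m p).
  rewrite /blkT mulmxBl dotDr dotNr mulmx_suml; congr (_ - _).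
    rewrite /blkdiag /p !mul_block_col !mul0mx !addr0 dot_col.
    by rewrite col_mx0 addr0 dot0r addr0.
  rewrite (big_morph (dot p) (dotDr p) (dot0r p)).
  by apply: eq_bigr => i _; rewrite -scalemxAl dotZr.
rewrite blkTE /blkB1 /blkB2 /Delta1 /Delta2 /Xi1 /Xi2 /blkdiag.
rewrite !tr_row_mx /p.
rewrite !(mul_row_col, mul_col_mx, mul_block_col, mul0mx, mulmx0, add0r, addr0).
rewrite ?add_col_mx !dot_col !trmx0 !mul0mx !trmxK.
rewrite ?(mulmxDl, mulmxBl) ?mulNmx -?scalemxAl !(dotDr, dotNr) -!dot_mulmxl.
rewrite ?(mulmxDl, mulNmx, mul_scalar_mx, dotDr, dotDl, dotNr, dotNl, dotZr, dotZl, dot0r).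
rewrite -?(dot_mulmxl L) (dotC (G *m c)); ring.
Qed.

(** * Dissipation along the closed loop *)

(** The event-triggered condition e^T e <= sigma^2 v^T v absorbed by the
    multiplier 1 / alpha: completing the squares, the left-hand side is
    (e^T e - sigma^2 v^T v) / alpha - |alpha c - e|^2 / alpha.  The vector r
    minimizes the part of the expression in which it occurs.  When alpha = 0
    the convention x / 0 = 0 gives r = 0, and the hypothesis on v removes the
    remaining term. *)
Lemma trigger_multiplier (R : realType) m n (alpha sigma : R)
    (c e : 'cV[R]_m) (v : 'cV[R]_n) :
  0 <= alpha -> 0 < sigma -> (alpha = 0 -> v = 0) ->
  dot e e <= sigma ^+ 2 * dot v v ->
  forall r, r = - (sigma ^+ 2 / alpha) *: v ->
  2 * dot c e - alpha * dot c c + 2 * dot v r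
    + alpha / sigma ^+ 2 * dot r r <= 0.
Proof.
move=> alpha0 sigma0 v0 ev r ->.
have [a0|an0] := eqVneq alpha 0.
  have {}v0 := v0 a0; rewrite v0 dot0r mulr0 in ev.
  have e0 : e = 0 by apply: dotvv_eq0; apply/eqP; rewrite eq_le ev dotvv_ge0.
  rewrite v0 e0 a0 scaler0 !dot0r; lra.
have apos : 0 < alpha by rewrite lt_def an0.
have sn0 : sigma != 0 by rewrite gt_eqF.
have sq := dotvv_ge0 (alpha *: c - e).
rewrite !(dotDr, dotDl, dotNr, dotNl, dotZr, dotZl) (dotC e) in sq *.
rewrite -(pmulr_rle0 _ apos).
(* both sides are multiplied by alpha to clear the denominators *)
set X := (X in X <= 0).
have -> : X = alpha * (2 * dot c e) - alpha ^+ 2 * dot c c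
              - sigma ^+ 2 * dot v v.
  by rewrite /X; field; rewrite an0 sn0.
nra.
Qed.

(** The dissipation inequality for one step of the closed loop.  The first
    block of the test vector is W p, on which the positivity of the compressed
    matrices W^T Psi_i W applies; after the substitution, everything outside the
    two trigger multipliers and the Psi_i terms is the claimed inequality. *)
Lemma lmi_dissipation (R : realType) (nx nu nd ny T : nat)
    (E : 'M[R]_(nx, nd)) (C : 'M[R]_(ny, nx)) (D : 'M[R]_(ny, nu))
    (Psi : nat -> 'M[R]_(nx + (nx + nu))) (sigmax sigmau : R)
    (Pbar : 'M[R]_nx) (L : 'M[R]_(nu, nx)) (G : 'M[R]_nu)
    (gamma alpha1 alpha2 : R) (theta : 'I_T -> R)
    (A : 'M[R]_nx) (B : 'M[R]_(nx, nu))
    (x ex xnext : 'cV[R]_nx) (u eu : 'cV[R]_nu) (d : 'cV[R]_nd)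
    (y : 'cV[R]_ny) :
  let K := L *m invmx Pbar in
  let P := invmx Pbar in
  let W := col_mx 1%:M (col_mx A^T B^T) in
  0 < sigmax -> 0 < sigmau -> posdefmx Pbar ->
  0 <= alpha1 -> 0 <= alpha2 -> (forall i, 0 <= theta i) ->
  psdmx (lmi E C D Psi sigmax sigmau Pbar L G gamma alpha1 alpha2 theta) ->
  (forall i : 'I_T, psdmx (W^T *m Psi i *m W)) ->
  xnext = (A + B *m K) *m x - B *m K *m ex - B *m eu + E *m d ->
  y = C *m x + D *m K *m x - D *m K *m ex - D *m eu ->
  u = K *m (x - ex) ->
  norm2 ex <= sigmax * norm2 x -> norm2 eu <= sigmau * norm2 u ->
  dot xnext (P *m xnext) - dot x (P *m x) <= gamma ^+ 2 * dot d d - dot y y.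
Proof.
move=> K P W sigmax0 sigmau0 Ppos alpha10 alpha20 theta0 lmi0 hPsi.
move=> xnextE yE uE /(norm2_le_dot sigmax0) exx /(norm2_le_dot sigmau0) euu.
have Pu : Pbar \in unitmx by apply: unitmx_dot => v; exact: posdefmx_dot.
have form_ge0 p1 p2 p3 a b c w r s d' := psdmx_dot
  (col_mx (col_mx p1 (col_mx p2 p3)) (col_mx (col_mx a (col_mx b c))
    (col_mx w (col_mx (col_mx r s) d')))) lmi0.
have Psi0 : \sum_(i < T) theta i * dot (col_mx 0 (col_mx 0 0))
    (Psi i *m col_mx 0 (col_mx 0 0)) = 0.
  by apply: big1 => i _; rewrite !col_mx0 dot0l mulr0.
(* For alpha1 = 0 the form vanishes on the s-direction, so its cross term
   a^T Pbar s with a = s = x is zero. *)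
have x0 : alpha1 = 0 -> x = 0.
  move=> a0; apply: contrapT => /eqP /(posdefmx_dot Ppos).
  rewrite (_ : dot _ _ = 0) ?ltxx //.
  apply: (@affine_ge0_slope0 _ (dot x (Pbar *m x) / 2)) => t.
  have := form_ge0 0 0 0 x 0 0 0 0 (t *: x) 0; rewrite lmi_form Psi0 a0.
  rewrite -scalemxAr ?mulmx0 ?subr0 ?(dot0r, dot0l, dotZr); lra.
(* For alpha2 = 0 the form vanishes on the r-direction, and its cross term at
   a = P x, b = P ex, r = u is u^T u. *)
have u0 : alpha2 = 0 -> u = 0.
  move=> a0; apply: dotvv_eq0.
  have LE : L *m (P *m x) - L *m (P *m ex) = u.
    by rewrite uE mulmxBr !mulmxA.
  set a := P *m x in LE *; set b := P *m ex in LE *.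
  apply: (@affine_ge0_slope0 _ ((dot a (Pbar *m a)
      + 2 * dot b (Pbar *m b) - alpha1 * dot b b) / 2)) => t.
  have := form_ge0 0 0 0 a b 0 0 (t *: u) 0 0; rewrite lmi_form Psi0 a0 LE.
  rewrite ?mulmx0 ?(dot0r, dot0l, dotZr, dotZl); lra.
(* G + G^T >= alpha2 I, so G is invertible unless alpha2 = 0, where eu = 0. *)
have [c cE] : exists c, G *m c = eu.
  have [a0|an0] := eqVneq alpha2 0.
    rewrite u0 // dot0r mulr0 in euu; exists 0; rewrite mulmx0; symmetry.
    by apply: dotvv_eq0; apply/eqP; rewrite eq_le euu dotvv_ge0.
  have Gu : G \in unitmx.
    apply: unitmx_dot => c c0.
    have cpos : 0 < dot c c.
      rewrite lt_def dotvv_ge0 andbT.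
      by apply: contra c0 => /eqP /dotvv_eq0 ->.
    have apos : 0 < alpha2 by rewrite lt_def an0.
    have := form_ge0 0 0 0 0 0 c 0 0 0 0; rewrite lmi_form Psi0.
    rewrite ?mulmx0 ?(dot0r, dot0l).
    have := mulr_gt0 apos cpos; lra.
  by exists (invmx G *m eu); rewrite mulKVmx.
have multx := trigger_multiplier (P *m ex) alpha10 sigmax0 x0 exx erefl.
have multu := trigger_multiplier c alpha20 sigmau0 u0 euu erefl.
move: (- (sigmax ^+ 2 / alpha1) *: x) (- (sigmau ^+ 2 / alpha2) *: u)
  multx multu => s r multx multu.
(* p minimizes q |-> 2 q^T xnext + q^T Pbar q, with minimum - V(xnext) *)
pose p := - (P *m xnext).
have := form_ge0 p (A^T *m p) (B^T *m p) (P *m x) (P *m ex) c (- y) r s d.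
rewrite lmi_form cE.
have -> : L *m (P *m x) - L *m (P *m ex) = u by rewrite uE mulmxBr !mulmxA.
have -> : (C *m Pbar + D *m L) *m (P *m x) - D *m L *m (P *m ex)
    - D *m G *m c = y.
  by rewrite mulmxDl -[C *m _ *m _]mulmxA mulKVmx // -!mulmxA cE yE !mulmxA.
rewrite !mulKVmx // -!(dot_mulmxr A) -!(dot_mulmxr B).
have Psi_ge0 : 0 <= \sum_(i < T) theta i *
    dot (col_mx p (col_mx (A^T *m p) (B^T *m p)))
        (Psi i *m col_mx p (col_mx (A^T *m p) (B^T *m p))).
  apply: sumr_ge0 => i _; apply: mulr_ge0 => //.
  have := psdmx_dot p (hPsi i).
  by rewrite -!mulmxA dot_mulmxr trmxK /W !mul_col_mx mul1mx.
have xnextE' : A *m x + B *m (u - eu) + E *m d = xnext.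
  by rewrite xnextE uE !mulmxBr mulmxDl !mulmxA !addrA.
have pE : dot p (E *m d) + dot p (A *m x) + dot p (B *m (u - eu))
          = - dot xnext (P *m xnext).
  by rewrite (dotC xnext) -dotNl -/p -[in RHS]xnextE' !dotDr; ring.
have pP : dot p (Pbar *m p) = dot xnext (P *m xnext).
  by rewrite /p mulmxN mulKVmx // dotNl dotNr opprK dotC.
have PbarT : Pbar^T = Pbar by case: Ppos.
have Pxs : dot (P *m x) (Pbar *m s) = dot x s.
  by rewrite dot_mulmxr PbarT mulKVmx.
rewrite pE pP Pxs (dotC (P *m x)) dotNl dotNr; lra.
Qed.

(** * From dissipation to the energy bound *)

(** V >= 0 makes the telescoped inequality a bound on every partial sum.  Both
    energies may be infinite, so the limits are taken in the extended reals. *)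
Lemma energy_le_of_dissipation (R : realType) nd ny (gamma : R) (V : nat -> R)
    (d : nat -> 'cV[R]_nd) (y : nat -> 'cV[R]_ny) :
  V 0%N = 0 -> (forall k, 0 <= V k) ->
  (forall k, V k.+1 - V k <= gamma ^+ 2 * dot (d k) (d k) - dot (y k) (y k)) ->
  (energy y <= (gamma ^+ 2)%:E * energy d)%E.
Proof.
move=> V0 Vge0 diss.
have partial n : \sum_(0 <= k < n) norm2 (y k) ^+ 2 + V n
    <= gamma ^+ 2 * \sum_(0 <= k < n) norm2 (d k) ^+ 2.
  elim: n => [|n IHn]; first by rewrite !big_geq // V0; lra.
  rewrite !big_nat_recr //= !norm2_sqr; have := diss n; lra.
have ge0 m (v : nat -> 'cV[R]_m) k : (0 <= (norm2 (v k) ^+ 2)%:E)%E.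
  by rewrite lee_fin sqr_ge0.
apply: lime_le; first exact: is_cvg_nneseries.
apply: nearW => n; apply: (@le_trans _ _
    ((gamma ^+ 2)%:E * \sum_(0 <= k < n) (norm2 (d k) ^+ 2)%:E)%E).
  rewrite !sumEFin -EFinM lee_fin; have := partial n; have := Vge0 n; lra.
by apply: lee_wpmul2l; [rewrite lee_fin sqr_ge0 | exact: nneseries_lim_ge].
Qed.

Theorem theorem3 (R : realType) (nx nu nd ny T : nat)
    (hnx : (0 < nx)%N) (hnu : (0 < nu)%N) (hnd : (0 < nd)%N)
    (hny : (0 < ny)%N) (hT : (0 < T)%N)
    (E : 'M[R]_(nx, nd)) (C : 'M[R]_(ny, nx)) (D : 'M[R]_(ny, nu))
    (epsd epsx epsu : R)
    (hepsd : 0 < epsd) (hepsx : 0 < epsx) (hepsu : 0 < epsu)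
    (Astar : 'M[R]_nx) (Bstar : 'M[R]_(nx, nu))
    (hstab : stabilizable Astar Bstar)
    (xm : nat -> 'cV[R]_nx) (um : nat -> 'cV[R]_nu)
    (hdata : recorded_data Astar Bstar E T epsd epsx epsu xm um)
    (sigmax sigmau : R) (hsigmax : 0 < sigmax) (hsigmau : 0 < sigmau)
    (Pbar : 'M[R]_nx) (L : 'M[R]_(nu, nx)) (G : 'M[R]_nu)
    (gamma alpha1 alpha2 : R) (theta : 'I_T -> R)
    (hgamma : 0 < gamma)
    (hPbar : posdefmx Pbar)
    (halpha1 : 0 <= alpha1) (halpha2 : 0 <= alpha2)
    (htheta : forall i, 0 <= theta i)
    (hlmi : psdmx (lmi E C D (data_Psi E epsd epsx epsu xm um)
                       sigmax sigmau Pbar L G gamma alpha1 alpha2 theta)) :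
  let K := L *m invmx Pbar in
  let P := invmx Pbar in
  forall (A : 'M[R]_nx) (B : 'M[R]_(nx, nu)),
    data_Sigma E T epsd epsx epsu xm um (A, B) ->
    let sys := closed_loop A B E C D K sigmax sigmau in
    hinf_norm_le epsd sys gamma /\ lyapunov_matrix epsd sys gamma P.
Proof.
move=> K P A B hAB sys.
have lyap : lyapunov_matrix epsd sys gamma P.
  move=> x d y [ex [u [eu traj]]] _ V k.
  have [xE yE uE exx euu] := traj k.
  rewrite /V -!mulmxA; apply: (lmi_dissipation hsigmax hsigmau hPbar halpha1
    halpha2 htheta hlmi _ xE yE uE exx euu) => i.
  by apply: hAB; exact: ltn_ord.
split=> // x d y traj x0 dle _ _.
apply: (@energy_le_of_dissipation _ _ _ gamma (fun k => dot (x k) (P *m x k))).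
- by rewrite x0 dot0l.
- by move=> k; exact/psdmx_dot/psdmx_invmx.
- move=> k; have := lyap x d y traj dle k.
  by rewrite -!mulmxA.
Qed.
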